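(* Let $n \geq 4$ be a perfect square. Then there exists a unique (up to isomorphism) chordal$^*$ graph $G$ on $n$ vertices satisfying $\kappa(G) = (n - 1) - \lceil 2\sqrt{n}-2\,\rceil$.
   Context: All graphs are finite and simple. A graph is chordal if every cycle of length at least $4$ has a chord. A vertex is universal if it is adjacent to all other vertices. A chordal$^*$ graph is a chordal graph with no universal vertex. The vertex connectivity $\kappa(G)$ is the minimum cardinality of a subset $W\subset V(G)$ such that the induced subgraph of $G$ on $V(G)\setminus W$ is disconnected. *)

(* Defs.v *)
From HB Require Import structures.
From mathcomp Require Import all_boot.

Set Implicit Arguments.
Unset Strict Implicit.
Unset Printing Implicit Defensive.

Record sgraph := SGraph {
  vertex :> finType;
  adj : rel vertex;
  adj_sym : symmetric adj;
  adj_irrefl : irreflexive adj }.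

Definition giso (G H : sgraph) : Prop :=
  exists f : G -> H, bijective f /\ forall x y : G, adj (f x) (f y) = adj x y.

(* The vertices of c in cyclic order form a cycle of length size c; [next c x]
   is the successor of x along it. *)
Definition has_chord (G : sgraph) (c : seq G) : Prop :=
  exists x y : G,
    [/\ x \in c, y \in c, adj x y, y != next c x & x != next c y].

Definition chordal (G : sgraph) : Prop :=
  forall c : seq G, ucycle (@adj G) c -> 4 <= size c -> has_chord c.

Definition universal (G : sgraph) (x : G) : Prop :=
  forall y : G, y != x -> adj x y.

Definition chordal_star (G : sgraph) : Prop :=
  chordal G /\ ~ exists x : G, universal x.

Section Induced.
Variables (G : sgraph) (S : {set G}).

Definition induced_adj : rel {x : G | x \in S} :=
  fun u v => adj (val u) (val v).

Lemma induced_sym : symmetric induced_adj.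
Proof. by move=> u v; apply: adj_sym. Qed.

Lemma induced_irrefl : irreflexive induced_adj.
Proof. by move=> u; apply: adj_irrefl. Qed.

Definition induced : sgraph := SGraph induced_sym induced_irrefl.
End Induced.

Definition connected (G : sgraph) : bool :=
  [forall x : G, forall y : G, connect (@adj G) x y].

(* A set W whose removal disconnects G leaves at least two vertices, so the
   initial value #|G|.-1 only matters when no such W exists, i.e. when G is
   complete; this is the usual convention for complete graphs. *)
Definition kappa (G : sgraph) : nat :=
  \big[minn/#|G|.-1]_(W : {set G} | ~~ connected (induced (~: W))) #|W|.

(* Main.v *)
(** Write n = m ^ 2, so that the required connectivity is (m - 1) ^ 2. By the
    strong form of Dirac's lemma, every vertex of a chordal graph without
    universal vertex misses some simplicial vertex, and it suffices to look at a
    maximal independent set S of simplicial vertices. Each s in S has degree at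
    least kappa. With t = #|S|, double counting the pairs (s, v) with v a
    nonneighbour of s gives t (t - 1) + (n - t) <= t (n - 1 - kappa), that is
    (t - m) ^ 2 <= 0. Hence t = m and everything is tight: S has m elements, each
    vertex outside S misses exactly one of them, each s misses m - 1 vertices
    outside S, and the vertices outside S form a clique. *)

Require Import Defs.
From mathcomp Require Import all_boot all_order all_algebra.
From mathcomp Require Import reals zify.

Set Implicit Arguments.
Unset Strict Implicit.
Unset Printing Implicit Defensive.

(** * Chordless paths and cycles in chordal graphs *)

Fixpoint chordless (T : eqType) (e : rel T) (s : seq T) : bool :=
  if s is x :: s' then all (fun z => ~~ e x z) (behead s') && chordless e s'
  else true.

(** Induction on length: if [x] has a neighbour beyond its successor, shortcut to it; otherwise keep
    the first edge, which creates no chord at [x]. The [subseq] clause carries uniqueness and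
    avoidance over to [q]. *)
Lemma path_chordless (T : eqType) (e : rel T) (x : T) (p : seq T) :
  path e x p -> exists q : seq T,
    [/\ path e x q, last x q = last x p, chordless e (x :: q) & subseq q p].
Proof.
have [k] := ubnP (size p).
elim: k x p => // k IHk x [|z p]; first by exists [::].
rewrite [size _]/= ltnS [path _ _ _]/= => szp /andP[exz zp].
have [/hasP[w wp exw]|/hasPn nexp] := boolP (has (e x) p).
  case/splitPr: wp zp szp => p1 p2.
  rewrite cat_path [path _ _ (w :: _)]/= size_cat => /and3P[_ _ wp2] szp.
  case: (IHk x (w :: p2)) => [||q [xq lq cq sq]].
  - by apply: leq_ltn_trans szp; apply: leq_addl.
  - by rewrite /= exw.
  exists q; split => //; first by rewrite lq /= last_cat.
  apply: (subseq_trans sq); apply: (subseq_trans _ (subseq_cons _ z)).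
  exact: suffix_subseq.
case: (IHk z p szp zp) => q [zq lq cq sq].
exists (z :: q); split; rewrite /= ?exz //; last by rewrite eqxx.
by apply/andP; split=> //; apply/allP => y /(mem_subseq sq)/nexp.
Qed.

Lemma chordless_consecutive (T : eqType) (e : rel T) (s : seq T) (a b : T) :
  symmetric e -> irreflexive e -> chordless e s ->
  a \in s -> b \in s -> e a b ->
  exists p1 p2, s = p1 ++ a :: b :: p2 \/ s = p1 ++ b :: a :: p2.
Proof.
move=> esym eirr; elim: s => [|x s IHs] //= /andP[xs cs].
have head_edge c : c \in s -> e x c -> exists p2, s = c :: p2.
  case: s xs {IHs cs} => [|z s] //= /allP xs.
  rewrite inE => /orP[/eqP->|/xs/negPf->//]; by exists s.
rewrite !inE => /orP[/eqP->|as_] /orP[/eqP->|bs] eab.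
- by rewrite eirr in eab.
- by have [p2 ->] := head_edge b bs eab; exists [::], p2; left.
- rewrite esym in eab.
  by have [p2 ->] := head_edge a as_ eab; exists [::], p2; right.
- by have [p1 [p2 [->|->]]] := IHs cs as_ bs eab; exists (x :: p1), p2; [left|right].
Qed.

Lemma next_consecutive (T : eqType) (p1 p2 : seq T) (a b : T) :
  uniq (p1 ++ a :: b :: p2) -> next (p1 ++ a :: b :: p2) a = b.
Proof.
move=> u; rewrite next_nth mem_cat mem_head orbT.
have a_p1 : a \notin p1.
  by move: u; rewrite cat_uniq => /and3P[_ /norP[]].
case: p1 a_p1 {u} => [|y p1] /=; first by rewrite eqxx.
rewrite inE negb_or => /andP[ay a_p1].
by rewrite eq_sym (negPf ay) index_cat (negPf a_p1) /= eqxx addn0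
  nth_cat ltnNge leqnSn /= subSnn.
Qed.

Lemma next_last (T : eqType) (v : T) (s : seq T) :
  uniq (v :: s) -> next (v :: s) (last v s) = v.
Proof.
(* The index runs past the end of [s], and the default of [nth] is the head [v]: the cycle
   closes. *)
by move=> u; rewrite next_nth mem_last index_last // nth_default.
Qed.

(* A chordless path from x to y avoiding the closed neighbourhood of v closes
   up through v to a cycle whose only possible chord is xy. *)
Lemma chordal_common_neighbours (G : sgraph) (v x y : G) (p : seq G) :
  chordal G -> x != y -> adj v x -> adj v y ->
  path (@adj G) x (rcons p y) ->
  (forall z, z \in p -> (z != v) && ~~ adj v z) ->
  adj x y.
Proof.
move=> chG xy vx vy xpy vp; apply: contraT => nxy.
(* [chordless] allows repeated vertices, so the path is made simple first. *)
have := last_rcons x p y; case/shortenP: xpy => p0 xp0 up0 sp0 lp0.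
have [q [xq lq cq sq]] := path_chordless xp0; rewrite lp0 in lq.
have {sp0} sqp : {subset q <= rcons p y} by move=> z /(mem_subseq sq)/sp0.
have {up0 sq} uxq : uniq (x :: q).
  by apply: subseq_uniq up0; rewrite /= eqxx.
have vxq b : b \in x :: q -> (b != v) && (adj v b ==> (b == x) || (b == y)).
  rewrite inE => /orP[/eqP->|/sqp].
    rewrite eqxx implybT andbT; apply: contraTneq vx => ->; by rewrite adj_irrefl.
  rewrite mem_rcons inE => /orP[/eqP->|/vp/andP[-> /negPf->//]].
  rewrite eqxx orbT implybT andbT; apply: contraTneq vy => ->; by rewrite adj_irrefl.
have vNxq : v \notin x :: q by apply/negP => /vxq; rewrite eqxx.
have uc : uniq [:: v, x & q] by rewrite cons_uniq vNxq uxq.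
have nv : next [:: v, x & q] v = x by rewrite /= eqxx.
have ny : next [:: v, x & q] y = v by have := next_last uc; rewrite /= lq.
have ucy : ucycle (@adj G) [:: v, x & q].
  by rewrite /ucycle uc andbT /= vx rcons_path xq lq adj_sym vy.
have szc : 4 <= size [:: v, x & q].
  case: q xq lq {ucy cq sqp uxq vxq vNxq uc nv ny} => [_ /eqP|z [|//]] /=.
    by rewrite (negPf xy).
  by rewrite andbT => + zy; rewrite zy (negPf nxy).
(* A chord at [v] could only reach [x] or [y], its neighbours on the cycle; any other edge joins
   consecutive entries of the chordless path. *)
have [a [b []]] := chG _ ucy szc; rewrite [a \in _]inE [b \in _]inE.
case/orP=> [/eqP->|axq] /orP[/eqP->|bxq] ab.
- by rewrite adj_irrefl in ab.
- by have /andP[_] := vxq b bxq; rewrite ab => /orP[]/eqP->;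
    rewrite ?nv ?ny eqxx.
- rewrite adj_sym in ab; have /andP[_] := vxq a axq; rewrite ab => /orP[]/eqP->;
    by rewrite ?nv ?ny eqxx.
have [p1 [p2 [E|E]]] :=
  chordless_consecutive (@adj_sym G) (@adj_irrefl G) cq axq bxq ab.
  by move: uc; rewrite E => /(@next_consecutive _ (v :: p1)) ->; rewrite eqxx.
by move: uc; rewrite E => /(@next_consecutive _ (v :: p1)) -> _; rewrite eqxx.
Qed.

(** * Simplicial vertices and the strong form of Dirac's lemma *)

Definition simplicial_in (G : sgraph) (U : {set G}) (x : G) : bool :=
  [forall y in U, forall z in U,
     adj x y ==> adj x z ==> (y != z) ==> adj y z].

Lemma simplicial_inP (G : sgraph) (U : {set G}) (x : G) :
  reflect (forall y z, y \in U -> z \in U -> adj x y -> adj x z -> y != z ->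
             adj y z)
    (simplicial_in U x).
Proof.
apply: (iffP forall_inP) => [H y z yU zU xy xz yz|H y yU].
  by have /forall_inP/(_ z zU) := H y yU; rewrite xy xz yz.
by apply/forall_inP => z zU; apply/implyP => xy; apply/implyP => xz;
  apply/implyP; apply: H.
Qed.

(** Induction on [#|U|] inside a fixed graph, hence simpliciality relative to [U]. [C] is the
    component of [w] among the vertices of [U] missed by [v], and [S] is its boundary, a clique. All
    neighbours in [U] of a vertex of [C] lie in [C :|: S], so a vertex of [C] that is simplicial
    there suffices. *)
Lemma simplicial_nonneighbour (G : sgraph) (U : {set G}) (v w : G) :
  chordal G -> v \in U -> w \in U -> w != v -> ~~ adj v w ->
  exists x, [/\ x \in U, x != v, ~~ adj v x & simplicial_in U x].
Proof.
move=> chG; have [k] := ubnP #|U|.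
elim: k U v w => // k IHk U v w leUk vU wU wv nvw.
pose D := [set z in U | (z != v) && ~~ adj v z].
pose e := [rel a b : G | [&& adj a b, a \in D & b \in D]].
pose C := [set z | connect e w z].
pose S := [set z in U | adj v z && [exists c in C, adj c z]].
have wD : w \in D by rewrite inE wU wv nvw.
have CD : C \subset D.
  apply/subsetP => z; rewrite inE => /connectP[p + ->].
  by elim/last_ind: p => [|p y _] //; rewrite rcons_path last_rcons => /and4P[].
have CP c : c \in C -> [/\ c \in U, c != v & ~~ adj v c].
  by move=> /(subsetP CD); rewrite !inE => /and3P[].
have nbC c z : c \in C -> z \in U -> adj c z -> z \in C :|: S.
  move=> cC zU cz; rewrite in_setU; have [cU cv ncv] := CP c cC.
  have [vz|nvz] := boolP (adj v z).
    by apply/orP; right; rewrite inE zU vz; apply/exists_inP; exists c.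
  have zv : z != v by apply: contraNneq ncv => <-; rewrite adj_sym.
  apply/orP; left; move: (cC); rewrite !inE => wc.
  apply: connect_trans wc (connect1 _).
  by rewrite /= cz (subsetP CD) // inE zU zv.
have esym : connect_sym e.
  by apply: sym_connect_sym => a b; rewrite /= adj_sym; congr (_ && _); rewrite andbC.
have Sclique x y : x \in S -> y \in S -> x != y -> adj x y.
  rewrite !inE => /and3P[xU vx /exists_inP[c cC cx]].
  move=> /and3P[yU vy /exists_inP[d dC dy]] xy.
  have /connectP[p cp dE] : connect e c d.
    by move: cC dC; rewrite !inE esym; apply: connect_trans.
  (* The detour through [C] avoids the closed neighbourhood of [v]. *)
  apply: (@chordal_common_neighbours G v x y (c :: p)) => //.
    rewrite /= adj_sym cx rcons_path -dE dy andbT.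
    by apply: sub_path cp => a b /and3P[].
  suff pC : {subset c :: p <= C} by move=> z /pC/CP[_ -> ->].
  move=> z zp; move: cC; rewrite !inE => /connect_trans; apply.
  by have := path_connect cp zp.
have subU : C :|: S \subset U.
  by apply/subsetP => z; rewrite in_setU => /orP[/CP[]//|]; rewrite inE => /andP[].
have cardU : #|C :|: S| < k.
  rewrite ltnS in leUk; apply: leq_trans leUk; apply: proper_card.
  apply/properP; split => //; exists v => //; rewrite in_setU negb_or.
  by rewrite [v \in S]inE adj_irrefl andbF andbT; apply/negP => /CP[_ /eqP].
suff [x xC sx] : exists2 x, x \in C & simplicial_in (C :|: S) x.
  have [xU xv nxv] := CP x xC; exists x; split=> //.
  apply/simplicial_inP => y z yU zU xy xz; move/simplicial_inP: sx; apply => //.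
    exact: nbC xy.
  exact: nbC xz.
(* If some [a] in [S] misses a vertex of [C :|: S], induction gives a simplicial vertex missed by
   [a], hence outside the clique [S]. *)
have [/exists_inP[a aS /exists_inP[b bU /andP[ba nab]]]|] :=
  boolP [exists a in S, exists b in C :|: S, (b != a) && ~~ adj a b].
  have aU : a \in C :|: S by rewrite in_setU aS orbT.
  have [x [xU xa nax sx]] := IHk _ _ _ cardU aU bU ba nab.
  exists x => //; move: xU; rewrite in_setU => /orP[//|xS].
  by rewrite (Sclique a x) // eq_sym in nax.
rewrite negb_exists_in => /forall_inP Suniv.
have {}Suniv a b : a \in S -> b \in C :|: S -> b != a -> adj a b.
  move=> aS bU ba; have := Suniv a aS; rewrite negb_exists_in => /forall_inP/(_ b bU).
  by rewrite ba negbK.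
(* Now members of [S] see all of [C :|: S], so a simplicial vertex missed by any [a] lies in [C]. If
   no such [a] exists, [C :|: S] is complete and [w] works. *)
have [/exists_inP[a aU /exists_inP[b bU /andP[ba nab]]]|] :=
  boolP [exists a in C :|: S, exists b in C :|: S, (b != a) && ~~ adj a b].
  have [x [xU xa nax sx]] := IHk _ _ _ cardU aU bU ba nab.
  exists x => //; move: xU; rewrite in_setU => /orP[//|xS].
  by rewrite adj_sym (Suniv x a) // eq_sym in nax.
rewrite negb_exists_in => /forall_inP compl.
exists w; first by rewrite inE.
apply/simplicial_inP => y z yU zU _ _ yz.
have := compl y yU; rewrite negb_exists_in => /forall_inP/(_ z zU).
by rewrite eq_sym yz negbK.
Qed.

(** * Bounds on vertex connectivity *)

Lemma kappa_le (G : sgraph) (W : {set G}) :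
  ~~ connected (induced (~: W)) -> kappa G <= #|W|.
Proof.
rewrite /kappa => dW; have := mem_index_enum W.
elim: (index_enum _) => //= X r IHr; rewrite inE big_cons.
case/orP=> [/eqP<-|/IHr Wr]; first by rewrite dW geq_minl.
by case: ifP => // _; apply: leq_trans (geq_minr _ _) Wr.
Qed.

Lemma kappa_ge (G : sgraph) (k : nat) :
  k <= #|G|.-1 ->
  (forall W : {set G}, ~~ connected (induced (~: W)) -> k <= #|W|) ->
  k <= kappa G.
Proof.
by move=> kG kW; apply: (big_ind (leq k)) => // a b; rewrite leq_min => -> ->.
Qed.

(** A path avoiding [W] that starts in [A] never leaves [A]. *)
Lemma kappa_le_separator (G : sgraph) (A W : {set G}) (x y : G) :
  x \in A -> x \notin W -> y \notin A -> y \notin W ->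
  (forall a b, a \in A -> b \notin A -> b \notin W -> ~~ adj a b) ->
  kappa G <= #|W|.
Proof.
rewrite -!in_setC => xA xW yA yW sepA; apply: kappa_le.
apply/negP => /forallP/(_ (Sub x xW))/forallP/(_ (Sub y yW))/connectP[p xp yE].
suff : val (last (Sub x xW : induced (~: W)) p) \in A.
  by rewrite -yE /= => yA'; rewrite inE yA' in yA.
have : val (Sub x xW : induced (~: W)) \in A by [].
elim: p (Sub x xW : induced (~: W)) xp {yE} => //= z p IHp u /andP[uz zp] uA.
apply: IHp => //; apply: contraTT uz => zA; apply: sepA => //.
by have := valP z; rewrite inE.
Qed.

(** * Counting nonneighbours *)

Definition nonneighbours (G : sgraph) (s : G) : {set G} :=
  [set v | (v != s) && ~~ adj s v].

Lemma nonneighbours_sym (G : sgraph) (s v : G) :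
  (v \in nonneighbours s) = (s \in nonneighbours v).
Proof. by rewrite !inE eq_sym adj_sym. Qed.

(** The neighbourhood of [s] separates [s] from any nonneighbour, so [kappa G] is at most the degree
    of [s]. *)
Lemma kappa_nonneighbours (G : sgraph) (s : G) :
  nonneighbours s != set0 -> kappa G + #|nonneighbours s| < #|G|.
Proof.
case/set0Pn=> v; rewrite inE => /andP[vs nsv].
pose W := [set z | adj s z].
have kW : kappa G <= #|W|.
  apply: (@kappa_le_separator G [set s] W s v);
    rewrite ?inE ?adj_irrefl ?eqxx //.
  by move=> a b; rewrite !inE => /eqP->.
have -> : nonneighbours s = ~: (s |: W).
  by apply/setP => z; rewrite !inE negb_or.
have : s \notin W by rewrite inE adj_irrefl.
have := cardsC (s |: W); rewrite cardsU1 => + sW; rewrite sW => E; lia.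
Qed.

Lemma nonneighbours_neq0 (G : sgraph) (s : G) :
  ~ universal s -> nonneighbours s != set0.
Proof.
move=> nus; apply/negP => /eqP n0; apply: nus => y ys; apply: contraT => nsy.
by rewrite -(in_set0 y) -n0 inE ys.
Qed.

Lemma sum_nonneighbours (G : sgraph) (S : {set G}) :
  \sum_(s in S) #|nonneighbours s| =
  \sum_v #|[set s in S | v \in nonneighbours s]|.
Proof.
under eq_bigr do rewrite -sum1_card big_mkcond.
rewrite exchange_big; apply: eq_bigr => v _.
rewrite -big_mkcondr -sum1_card; apply: eq_bigl => s.
by rewrite [RHS]inE.
Qed.

(** * Maximal independent sets of simplicial vertices *)

Definition independent (G : sgraph) (S : {set G}) : bool :=
  [forall s in S, forall t in S, ~~ adj s t].

Lemma independentP (G : sgraph) (S : {set G}) :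
  reflect {in S &, forall s t, ~~ adj s t} (independent S).
Proof.
apply: (iffP forall_inP) => [H s t sS tS|H s sS].
  by have /forall_inP/(_ t tS) := H s sS.
by apply/forall_inP => t tS; apply: H.
Qed.

(* Adjacent simplicial vertices have the same closed neighbourhood, so the
   members of a maximal independent set of simplicial vertices already witness
   that no vertex is universal. *)
Lemma simplicial_cover (G : sgraph) :
  chordal_star G ->
  exists S : {set G},
    [/\ independent S, {in S, forall s, simplicial_in setT s} &
        forall v, exists2 s, s \in S & v \in nonneighbours s].
Proof.
case=> chG nuG.
pose P (S : {set G}) := independent S && (S \subset simplicial_in setT).
have P0 : P set0.
  apply/andP; split; first by apply/independentP => s t; rewrite inE.
  by apply/subsetP => s; rewrite inE.
have [S /maxsetP[/andP[indS /subsetP simS] maxS] _] := maxset_exists P0.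
exists S; split=> // v.
have /set0Pn[w] : nonneighbours v != set0.
  by apply: nonneighbours_neq0 => uv; apply: nuG; exists v.
rewrite inE => /andP[wv nvw].
have [x [_ xv nvx simx]] := simplicial_nonneighbour chG (in_setT v) (in_setT w) wv nvw.
(* Either [x] itself serves, or a neighbour of [x] in [S] does, or [x] could be added to [S] against
   maximality. *)
have [xS|xS] := boolP (x \in S).
  by exists x => //; rewrite nonneighbours_sym inE xv.
have [/exists_inP[s sS xs]|] := boolP [exists s in S, adj x s].
  exists s => //; rewrite inE; apply/andP; split.
    by apply: contraNneq nvx => ->; rewrite adj_sym.
  apply: contraNN nvx => sv; rewrite adj_sym.
  have /simplicial_inP := simS s sS; apply; rewrite ?inE //.
  by rewrite adj_sym.
rewrite negb_exists_in => /forall_inP nxS.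
suff E : x |: S = S by rewrite -E setU11 in xS.
apply: maxS (subsetUr _ _); apply/andP; split; last first.
  by apply/subsetP => s /setU1P[->//|/simS].
apply/independentP => s t /setU1P[->|sS] /setU1P[->|tS].
- by rewrite adj_irrefl.
- exact: nxS.
- by rewrite adj_sym; apply: nxS.
- by move/independentP: indS; apply.
Qed.

(** * The structure forced by equality in the count *)

Record extremal_structure (G : sgraph) (m : nat) (S : {set G}) : Prop :=
  ExtremalStructure {
  extremal_card : #|S| = m;
  extremal_independent : independent S;
  extremal_part : forall s, s \in S -> #|nonneighbours s :\: S| = m.-1;
  extremal_missed : forall v, v \notin S ->
    #|[set s in S | v \in nonneighbours s]| = 1;
  extremal_clique : forall u v, u \notin S -> v \notin S -> u != v -> adj u v }.

Lemma sqr_amgm_eq (m t : nat) : m * m + t * t <= 2 * m * t -> t = m.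
Proof.
move=> h; have [|] := leqP t m => [/subnK tm|/ltnW/subnK mt].
  by have := leq0n (m - t); nia.
by have := leq0n (t - m); nia.
Qed.

Lemma extremal_structure_exists (G : sgraph) (m : nat) :
  1 < m -> chordal_star G -> #|G| = m ^ 2 -> kappa G = m.-1 ^ 2 ->
  exists S : {set G}, extremal_structure m S.
Proof.
move=> m1 csG cardG kG; have [S [indS simS cov]] := simplicial_cover csG.
exists S; have /independentP iS := indS.
pose b v := #|[set s in S | v \in nonneighbours s]|.
have bS v : v \in S -> b v = #|S|.-1.
  move=> vS; rewrite (cardsD1 v S) vS /b; apply: eq_card => s.
  rewrite !inE eq_sym; have [sS|] := boolP (s \in S); last by rewrite andbF.
  by rewrite iS // !andbT.
have b1 v : 1 <= b v.
  by have [s sS vs] := cov v; apply/card_gt0P; exists s; rewrite inE sS.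
(* The bound is n - 1 - kappa for n = m ^ 2 and kappa = (m - 1) ^ 2. *)
have nS s : s \in S -> #|nonneighbours s| <= 2 * m.-1.
  move=> sS; have : nonneighbours s != set0.
    by apply: nonneighbours_neq0 => us; case: csG => _; apply; exists s.
  move/kappa_nonneighbours; rewrite cardG kG -!mulnn.
  by case: (m) m1 => // m' _ /=; lia.
(* [leqif] keeps the equality cases: once the sums are tight, so is every term. *)
have upper := leqif_sum (fun s sS => leqif_eq (nS s sS)).
have lower := leqif_sum (fun v (_ : v \notin S) => leqif_eq (b1 v)).
have sumE : \sum_(s in S) #|nonneighbours s| =
    #|S| * #|S|.-1 + \sum_(v | v \notin S) b v.
  rewrite sum_nonneighbours (bigID (mem S)) /= -sum_nat_const.
  by congr (_ + _); apply: eq_bigr.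
rewrite !sum_nat_const in upper lower.
have cardCS : #|[predC S]| + #|S| = m ^ 2 by rewrite addnC cardC.
have {}lower : #|[predC S]| * 1 <= \sum_(v | v \notin S) b v
    ?= iff [forall (v | v \notin S), 1 == b v] by exact: lower.
have [uppe uppeq] := upper; have [lowe loweq] := lower.
have cardS : #|S| = m.
  apply: sqr_amgm_eq; move: uppe lowe cardCS.
  rewrite sumE muln1 -mulnn; move: (\sum_(v | _) _) #|[predC S]| #|S| => k c t.
  by case: t m1 => [|t]; case: (m) => // m' _ /=; lia.
have /eqP uppeq' : \sum_(s in S) #|nonneighbours s| == #|S| * (2 * m.-1).
  rewrite eqn_leq uppe /=; move: lowe cardCS.
  rewrite sumE cardS muln1 -mulnn; move: (\sum_(v | _) _) #|[predC S]| => k c.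
  by case: (m) m1 => // m' _ /=; lia.
have loweq' : \sum_(v | v \notin S) b v == #|[predC S]| * 1.
  rewrite eqn_leq lowe andbT; move: uppe cardCS.
  rewrite sumE cardS muln1 -mulnn; move: (\sum_(v | _) _) #|[predC S]| => k c.
  by case: (m) m1 => // m' _ /=; lia.
rewrite uppeq' eqxx in uppeq; rewrite eq_sym loweq' in loweq.
have missed v : v \notin S -> b v = 1.
  by move=> vS; have /forall_inP/(_ v vS)/eqP := esym loweq.
split=> // [s sS|u v uS vS uv].
  have /forall_inP/(_ s sS)/eqP := esym uppeq.
  rewrite -(cardsID S); have -> : nonneighbours s :&: S = S :\ s.
    apply/setP => v; rewrite !inE; have [vS|] := boolP (v \in S).
      by rewrite iS // andbT.
    by rewrite !andbF.
  by have := cardsD1 s S; rewrite sS cardS; lia.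
(* No simplicial [s] sees both [u] and [v], so each member of [S] is missed by one of them; as each
   misses just one member, [m <= 2]. *)
apply: contraT => nuv.
have miss_uv s : s \in S -> adj s u -> adj s v -> False.
  move=> sS su sv; have /simplicial_inP := simS s sS.
  by move=> /(_ u v); rewrite !inE => /(_ isT isT su sv uv); rewrite (negPf nuv).
have m2 : m = 2.
  suff : #|S| <= b u + b v by rewrite !missed // cardS; lia.
  rewrite -cardsUI; apply: leq_trans (leq_addr _ _); apply: subset_leq_card.
  apply/subsetP => s sS; rewrite !inE sS.
  have -> /= : u != s by apply: contraNneq uS => ->.
  have -> /= : v != s by apply: contraNneq vS => ->.
  by rewrite -negb_and; apply/negP => /andP[]; apply: miss_uv.
have Kuv : [set u; v] = ~: S.
  apply/eqP; rewrite eqEcard cards2 uv; apply/andP; split.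
    by apply/subsetP => z; rewrite !inE => /orP[]/eqP->.
  by have := cardsC S; rewrite cardS cardG m2; lia.
(* For [m = 2] the connectivity should be 1, but [u] and its neighbours in [S] have no edge to the
   other vertices, so the empty set already separates [u] from [v]. *)
suff : kappa G <= #|@set0 G| by rewrite cards0 kG m2.
apply: (@kappa_le_separator G (u |: [set s in S | adj s u]) _ u v);
  rewrite ?inE ?eqxx ?(negPf vS) ?orbF //; first by rewrite eq_sym.
move=> a c /setU1P[->|]; rewrite !inE negb_or.
  move=> /andP[cu]; have [cS /= ncu _|cS _ _] := boolP (c \in S).
    by rewrite adj_sym.
  have : c \in [set u; v] by rewrite Kuv inE.
  by rewrite !inE (negPf cu) => /eqP->.
move=> /andP[aS au] /andP[cu _] _.
have [cS|cS] := boolP (c \in S); first exact: iS.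
have : c \in [set u; v] by rewrite Kuv inE.
by rewrite !inE (negPf cu) => /eqP->; apply/negP; apply: miss_uv.
Qed.

(** * The extremal graph and its uniqueness *)

Definition is_tip (m : nat) (p : 'I_m * 'I_m) : bool := p.2 == 0 :> nat.

(* The tips (i, 0) form an independent set and the other vertices a clique;
   the tip (i, 0) misses exactly the clique vertices (i, j) of its own row. *)
Definition extremal_adj (m : nat) : rel ('I_m * 'I_m) :=
  fun p q => [&& p != q, ~~ (is_tip p && is_tip q) &
                 (is_tip p || is_tip q) ==> (p.1 != q.1)].

Lemma extremal_adj_sym (m : nat) : symmetric (@extremal_adj m).
Proof.
move=> p q; rewrite /extremal_adj eq_sym andbC [_ && is_tip q]andbC.
by rewrite [is_tip p || _]orbC [p.1 == _]eq_sym andbC.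
Qed.

Lemma extremal_adj_irrefl (m : nat) : irreflexive (@extremal_adj m).
Proof. by move=> p; rewrite /extremal_adj eqxx. Qed.

Definition extremal_graph (m : nat) : sgraph :=
  SGraph (@extremal_adj_sym m) (@extremal_adj_irrefl m).

Lemma card_extremal_graph (m : nat) : #|extremal_graph m| = m ^ 2.
Proof. by rewrite card_prod !card_ord mulnn. Qed.

(** Tips are never consecutive on a cycle, and two nonconsecutive clique vertices give a chord; such
    a pair is found among the first five vertices. *)
Lemma extremal_graph_chordal (m : nat) : chordal (extremal_graph m).
Proof.
pose tip (p : extremal_graph m) := is_tip p.
have cliqueK (p q : extremal_graph m) : ~~ tip p -> ~~ tip q -> p != q -> adj p q.
  by rewrite /= /extremal_adj /tip => /negPf-> /negPf-> ->.
have indepS (p q : extremal_graph m) : adj p q -> ~~ (tip p && tip q).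
  by case/and3P.
case=> [|a [|b [|c [|d r]]]] // /andP[cyc u] _.
move: cyc u; rewrite [cycle _ _]/= [uniq _]/= !inE !negb_or.
case/and4P=> ab bc cd dr.
case/and5P=> /and4P[nab nac nad nar] /and3P[nbc nbd nbr] /andP[ncd ncr] ndr ur.
have [ac|] := boolP (~~ tip a && ~~ tip c).
  case/andP: ac => ta tc; exists a, c; split; rewrite ?inE ?eqxx ?orbT //.
  - exact: cliqueK.
  - by rewrite /= eqxx eq_sym.
  - by rewrite /= !(eq_sym c) (negPf nac) (negPf nbc) eqxx.
have [bd _|] := boolP (~~ tip b && ~~ tip d).
  case/andP: bd => tb td; exists b, d; split; rewrite ?inE ?eqxx ?orbT //.
  - exact: cliqueK.
  - by rewrite /= (eq_sym b a) (negPf nab) eqxx eq_sym.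
  rewrite /= !(eq_sym d) (negPf nad) (negPf nbd) (negPf ncd).
  case: r nbr {nar ncr ndr ur dr} => [|f r] /=; first by rewrite eqxx eq_sym.
  by rewrite inE eqxx => /norP[].
(* What remains is [a] and [d] tips, [b] and [c] not. Length four would make the tips [d] and [a]
   adjacent; otherwise the vertex [f] after [d] is no tip, and [b], [f] span a chord. *)
have := indepS _ _ ab; have := indepS _ _ bc; have := indepS _ _ cd.
case ta: (tip a); case tb: (tip b) => //; case tc: (tip c) => //;
  case td: (tip d) => // _ _ _ _ _.
case: r nar nbr ncr ndr ur dr => [|f r] /=.
  by rewrite andbT => _ _ _ _ _ /(indepS d a); rewrite ta td.
rewrite !inE !negb_or => /andP[naf nar] /andP[nbf nbr] /andP[ncf ncr] /andP[ndf ndr].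
case/andP=> nfr ur /andP[df fr].
have tf : ~~ tip f by have := indepS d f df; rewrite td.
exists b, f; split; rewrite ?inE ?eqxx ?orbT //.
- by apply: cliqueK => //; rewrite tb.
- by rewrite /= (eq_sym b a) (negPf nab) eqxx eq_sym.
- rewrite /= !(eq_sym f) (negPf naf) (negPf nbf) (negPf ncf) (negPf ndf).
  case: r nbr {nar ncr ndr nfr ur fr} => [|g r] /=; first by rewrite eqxx eq_sym.
  by rewrite inE eqxx => /norP[].
Qed.

Lemma extremal_graph_chordal_star (m : nat) :
  1 < m -> chordal_star (extremal_graph m).
Proof.
move=> m1; split; first exact: extremal_graph_chordal.
case=> -[i j] uij.
(* A tip misses [(i, 1)], any other vertex misses the tip [(i, 0)]; [Ordinal m1] is the index 1. *)
have [j0|j0] := boolP (j == 0 :> nat).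
  have ne : (i, Ordinal m1) != (i, j) by apply: contraTneq j0 => -[<-].
  by have /and3P[_ _] := uij _ ne; rewrite /is_tip /= j0 eqxx.
have ne : (i, Ordinal (ltnW m1)) != (i, j) by apply: contraNneq j0 => -[<-].
by have /and3P[_ _] := uij _ ne; rewrite /is_tip /= !eqxx orbT.
Qed.

(** [N i] is the neighbourhood of the tip [(i, 0)]. Removing [N o] isolates the tip [(o, o)]; a
    smaller [W] leaves a clique vertex in every [N i], so each surviving tip stays joined to the
    surviving clique. *)
Lemma kappa_extremal_graph (m : nat) :
  1 < m -> kappa (extremal_graph m) = m.-1 ^ 2.
Proof.
move=> m1; pose o := Ordinal (ltnW m1).
pose N i : {set extremal_graph m} := setX [set~ i] [set~ o].
have cardN i : #|N i| = m.-1 ^ 2 by rewrite cardsX !cardsC1 card_ord mulnn.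
have tipE p : @is_tip m p = (p.2 == o) by [].
apply/eqP; rewrite eqn_leq; apply/andP; split.
  rewrite -(cardN o).
  apply: (@kappa_le_separator (extremal_graph m) [set (o, o)] (N o) (o, o)
    (o, Ordinal m1)).
  - by rewrite inE.
  - by rewrite !inE eqxx.
  - by rewrite !inE xpair_eqE eqxx.
  - by rewrite !inE eqxx.
  move=> a [k l]; rewrite !inE => /eqP-> kl /=.
  rewrite /extremal_adj !tipE /= ?eqxx /=.
  by rewrite negb_and !negbK => /orP[]/eqP->; rewrite ?eqxx ?andbF.
apply: kappa_ge => [|W].
  by rewrite card_extremal_graph -!mulnn; move: (m1); case: (m) => // k _ /=; lia.
apply: contraR; rewrite -ltnNge => cW.
have out i : exists2 p, p \in N i & p \notin W.
  suff : ~~ (N i \subset W) by case/subsetPn=> p; exists p.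
  by apply/negP => /subset_leq_card; rewrite cardN leqNgt cW.
have [k0 k0N] := out o; rewrite -in_setC => k0W.
have k0tip : ~~ is_tip k0.
  by move: k0N; rewrite tipE !inE => /andP[].
pose H := induced (~: W).
have to_k0 (x : H) : connect (@adj H) x (Sub k0 k0W).
  have toK (y : H) : ~~ is_tip (val y) -> connect (@adj H) y (Sub k0 k0W).
    move=> ty; have [/eqP yk|yk] := boolP (val y == k0).
      by rewrite (_ : y = Sub k0 k0W) ?connect0 //; apply: val_inj.
    apply: connect1.
    by rewrite /= /induced_adj /= /extremal_adj (negPf ty) (negPf k0tip) yk.
  have [tx|] := boolP (is_tip (val x)); last exact: toK.
  have [p pN] := out (val x).1; rewrite -in_setC => pW.
  have ptip : ~~ is_tip p by move: pN; rewrite tipE !inE => /andP[].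
  apply: connect_trans (toK (Sub p pW) _); last by rewrite /= ptip.
  apply: connect1; rewrite /= /induced_adj /= /extremal_adj tx (negPf ptip) /=.
  move: pN; rewrite !inE => /andP[px _]; rewrite [(val x).1 == _]eq_sym px andbT.
  by apply: contraNneq ptip => <-.
apply/forallP => x; apply/forallP => y; apply: connect_trans (to_k0 x) _.
by rewrite sym_connect_sym //; apply: adj_sym.
Qed.

(** Row [i] is sent to the [i]-th vertex of [S] followed by the vertices outside [S] that it misses.
    By [extremal_missed] these images are disjoint, so the map is injective, and equal cardinality
    makes it bijective. *)
Lemma extremal_structure_giso (G : sgraph) (m : nat) (S : {set G}) :
  0 < m -> #|G| = m ^ 2 -> extremal_structure m S -> giso (extremal_graph m) G.
Proof.
move=> m0 cardG [cardS /independentP indS part missed clique].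
pose sv i := enum_val (cast_ord (esym cardS) i).
have svS i : sv i \in S by apply: enum_valP.
have sv_inj : injective sv by move=> i j /enum_val_inj/cast_ord_inj.
pose K i := nonneighbours (sv i) :\: S.
(* The list has [m] entries, so the default of [nth] is never reached; entry 0 is the image of the
   tip. *)
pose f (p : extremal_graph m) := nth (sv p.1) (sv p.1 :: enum (K p.1)) p.2.
have ftip p : is_tip p -> f p = sv p.1 by rewrite /f => /eqP->.
have szK i : size (enum (K i)) = m.-1 by rewrite -cardE part.
have fK p : ~~ is_tip p -> f p \in K p.1.
  case: p => i [[|j] jm] //= _; rewrite /f /= -mem_enum mem_nth // szK; lia.
have fS p : (f p \in S) = is_tip p.
  have [/ftip->|/fK] := boolP (is_tip p); first exact: svS.
  by rewrite inE => /andP[/negPf].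
have missE i p : ~~ is_tip p -> (f p \in nonneighbours (sv i)) = (i == p.1).
  move=> tp; have := fK p tp; rewrite inE => /andP[fpS fpn].
  apply/idP/eqP => [fpi|->//]; apply: sv_inj.
  have /eqP/cards1P[s sE] := missed _ fpS.
  have : sv i \in [set s] by rewrite -sE inE svS.
  have : sv p.1 \in [set s] by rewrite -sE inE svS.
  by rewrite !inE => /eqP-> /eqP->.
have f_inj : injective f.
  move=> p q E; have := fS p; rewrite E fS => /esym tpq.
  have [tp|tp] := boolP (is_tip p).
    have tq : is_tip q by rewrite -tpq.
    move: E; rewrite !ftip // => /sv_inj E1.
    case: p q E1 tp tq {tpq} => [i j] [k l] /= -> /eqP j0 /eqP l0.
    by congr (_, _); apply: val_inj; rewrite /= j0 l0.
  have tq : ~~ is_tip q by rewrite -tpq.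
  have /eqP E1 : p.1 == q.1 by rewrite -missE // -E missE.
  move: E; rewrite /f -E1 => /eqP; rewrite nth_uniq.
  - by case: p q E1 {tp tq tpq} => [i j] [k l] /= -> /eqP/val_inj->.
  - by rewrite /= szK; case: p.2 => /= j; lia.
  - by rewrite /= szK; case: q.2 => /= j; lia.
  by rewrite /= enum_uniq andbT mem_enum !inE svS.
exists f; split.
  by apply: inj_card_bij => //; rewrite cardG card_extremal_graph.
have adjSK p q : is_tip p -> ~~ is_tip q -> adj (f p) (f q) = (p.1 != q.1).
  move=> tp tq; rewrite (ftip p tp) -(missE p.1 q tq) inE negb_and !negbK.
  suff /negPf-> : f q != sv p.1 by [].
  by apply: contraNneq tq => E; rewrite -fS E.
move=> p q; rewrite /= /extremal_adj.
case: (boolP (is_tip p)) (boolP (is_tip q)) => tp [] tq /=.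
- by rewrite andbF; apply/negbTE/indS; rewrite fS.
- by rewrite adjSK // andb_idl //; apply: contraNneq => ->.
- rewrite adj_sym adjSK // [q.1 == _]eq_sym andb_idl //.
  by apply: contraNneq => ->.
rewrite andbT; have [->|pq] := eqVneq p q; first exact: adj_irrefl.
by apply: clique; rewrite ?fS // (inj_eq f_inj).
Qed.

(** * The real expression for the connectivity, and the conclusion *)

Import Order.TTheory GRing.Theory Num.Theory.

Local Open Scope ring_scope.

Theorem theorem2p2 (R : realType) (n : nat) (hn : (4 <= n)%N)
    (hsq : exists m : nat, n = (m ^ 2)%N) :
  let P (G : sgraph) : Prop :=
    [/\ chordal_star G, #|G| = n &
        (kappa G)%:Z = (n%:Z - 1) - Num.ceil (2 * Num.sqrt (n%:R : R) - 2)] in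
  exists G : sgraph, P G /\ forall H : sgraph, P H -> giso G H.
Proof.
case: hsq => m nE P; have m1 : (1 < m)%N.
  by case: m nE => [|[|m]] // nE; rewrite nE in hn.
(* The square root is [m], so the argument of [Num.ceil] is already an integer. *)
have ceilE : Num.ceil (2 * Num.sqrt (n%:R : R) - 2) = 2 * m%:Z - 2.
  rewrite nE natrX sqrtr_sqr ger0_norm ?ler0n //.
  by rewrite -[RHS](intrKceil (R := R)) rmorphB rmorphM.
(* This is (m ^ 2 - 1) - (2 m - 2) = (m - 1) ^ 2. *)
have kE (k : nat) :
    k%:Z = (n%:Z - 1) - Num.ceil (2 * Num.sqrt (n%:R : R) - 2) <->
    k = (m.-1 ^ 2)%N.
  rewrite ceilE nE -!mulnn; case: (m) m1 => // m' _ /=; split => h; lia.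
exists (extremal_graph m); split.
  split; first exact: extremal_graph_chordal_star.
    by rewrite card_extremal_graph.
  by apply/kE; apply: kappa_extremal_graph.
move=> H [csH cardH /kE kH]; rewrite nE in cardH.
have [S structS] := extremal_structure_exists m1 csH cardH kH.
by apply: extremal_structure_giso structS; first exact: ltnW.
Qed.
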